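(* Consider the numerical method $$\begin{pmatrix}x_{n+1}\\ y_{n+1}\end{pmatrix}=A\begin{pmatrix}x_n\\ y_n\end{pmatrix}+\alpha\, b\,\Delta W_n,\qquad A=\begin{pmatrix}a_{11}&a_{12}\\ a_{21}&a_{22}\end{pmatrix},\quad b=\begin{pmatrix}b_1\\ b_2\end{pmatrix},$$ with step-size $h>0$, approximating the linear stochastic oscillator (see context), and suppose (A1) $4\det(A)-(\mathrm{tr}(A))^2>0$; (A2) $\det(A)=1$. Then: (1) The method is symplectic, i.e. $\mathrm dx_{n+1}\wedge\mathrm dy_{n+1}=\mathrm dx_n\wedge\mathrm dy_n$ for all $n\ge0$. (2) The discrete mean velocity $B_N=\frac{x_N}{Nh}$, $N\ge1$, satisfies a large deviations principle (as $N\to\infty$, with speed $N$) with the good rate function $$J^h(y)=\frac{h\left[4-(\mathrm{tr}(A))^2\right]y^2}{4\alpha^2\left[(b_1+a_{12}b_2-a_{22}b_1)^2-b_1(a_{12}b_2-a_{22}b_1)(2-\mathrm{tr}(A))\right]}.$$ (3) Moreover, if (A1) and (A2) hold for all sufficiently small $h$ and, in addition, as $h\to0$, (B) $|a_{11}-1|+|a_{22}-1|+|a_{12}-h|+|a_{21}+h|=\mathcal O(h^2)$ and $|b_1|+|b_2-1|=\mathcal O(h)$, then the method asymptotically preserves the large deviations principle of the mean velocity $\{B_T\}_{T>0}$ of the exact solution, i.e. the modified rate function $J^h_{mod}(y)=J^h(y)/h$ satisfies $$\lim_{h\to0}J^h_{mod}(y)=J(y)\qquad\text{for all } y\in\mathbb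 R,$$ where $J(y)=\frac{y^2}{\alpha^2}$ is the rate function of the large deviations principle of $\{B_T\}_{T>0}$.
   Context: Let $\alpha>0$, $x_0,y_0\in\mathbb R$ and let $W$ be a one-dimensional standard Brownian motion on a complete filtered probability space. The linear stochastic oscillator is $\mathrm dX_t=Y_t\,\mathrm dt$, $\mathrm dY_t=-X_t\,\mathrm dt+\alpha\,\mathrm dW_t$, $(X_0,Y_0)=(x_0,y_0)$, and $B_T=X_T/T$; $\{B_T\}_{T>0}$ satisfies a large deviations principle as $T\to\infty$ (speed $T$) with good rate function $J(y)=y^2/\alpha^2$. Numerical method: for a step-size $h>0$, $t_n=nh$, $\Delta W_n=W_{t_{n+1}}-W_{t_n}$, started at $(x_0,y_0)$. The real matrix $A=A(h)$ and real vector $b=b(h)$ depend on the method and on the constant step-size $h$ (dependence suppressed in the notation), and throughout $b_1^2+b_2^2\ne0$. A family of real random variables $\{Z_N\}_{N\ge1}$ satisfies a large deviations principle with rate function $I$ (a lower semicontinuous function $\mathbb R\to[0,\infty]$; good if its level sets $\{I\le a\}$, $a\in[0,\infty)$, are compact) if $\liminf_{N\to\infty}\frac1N\log\mathbf P(Z_N\in U)\ge-\inf_UI$ for every open $U\subset\mathbb R$ and $\limsup_{N\to\infty}\frac1N\log\mathbf P(Z_N\in C)\le-\inf_CI$ for every closed $C\subset\mathbb R$. $R=\mathcal O(h^p)$ means $|R|\le Ch^p$ for all sufficiently small $h$, with $C$ independent of $h$. *)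

(* Defs.v *)
From HB Require Import structures.
From mathcomp Require Import all_boot all_order all_algebra.
From mathcomp Require Import all_classical all_reals all_analysis.

Set Implicit Arguments.
Unset Strict Implicit.
Unset Printing Implicit Defensive.

Import Order.TTheory GRing.Theory Num.Theory.
Import numFieldNormedType.Exports.

Local Open Scope classical_set_scope.
Local Open Scope ring_scope.

(** * Large deviations *)

Definition good_rate_function {R : realType} (I : R -> \bar R) : Prop :=
  [/\ lower_semicontinuous I,
      forall y, (0 <= I y)%E
    & forall a : R, 0 <= a -> compact [set y | (I y <= a%:E)%E]].

(* The index runs along the filter [F] of [K], which is [\oo] on [nat] for
   sequences and [+oo] on [R] for families in continuous time.  [lne] is the
   extended logarithm, so that [lne 0 = -oo], and [ereal_inf] of the empty set
   is [+oo]. *)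
Definition LDP {R : realType} {d : measure_display} {T : measurableType d}
    (P : probability T R) {K : topologicalType} (F : set_system K)
    (speed : K -> R) (Z : K -> T -> R) (I : R -> \bar R) : Prop :=
  (forall U : set R, open U ->
     (- ereal_inf (I @` U) <=
      limf_einf (fun k => (speed k)^-1%:E * lne (P (Z k @^-1` U))) F)%E) /\
  (forall C : set R, closed C ->
     (limf_esup (fun k => (speed k)^-1%:E * lne (P (Z k @^-1` C))) F <=
      - ereal_inf (I @` C))%E).

Definition LDP_good {R : realType} {d : measure_display} {T : measurableType d}
    (P : probability T R) {K : topologicalType} (F : set_system K)
    (speed : K -> R) (Z : K -> T -> R) (I : R -> \bar R) : Prop :=
  good_rate_function I /\ LDP P F speed Z I.

(** * Brownian motion and the stochastic oscillator *)

(* Time is a real number; only times [t >= 0] are meaningful. *)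
Definition complete_filtration {R : realType} {d : measure_display}
    {T : measurableType d} (P : probability T R) (F : R -> set (set T)) : Prop :=
  [/\ measure_is_complete P,
      forall t, 0 <= t -> sigma_algebra setT (F t),
      forall t, 0 <= t -> F t `<=` measurable,
      forall s t, 0 <= s -> s <= t -> F s `<=` F t
    & P.-negligible `<=` F 0].

Definition adapted {R : realType} {d : measure_display} {T : measurableType d}
    (F : R -> set (set T)) (X : R -> T -> R) : Prop :=
  forall t, 0 <= t -> forall B : set R, measurable B -> F t (X t @^-1` B).

Definition continuous_paths {R : realType} {d : measure_display}
    {T : measurableType d} (P : probability T R) (X : R -> T -> R) : Prop :=
  {ae P, forall w, {within `[0, +oo[, continuous (X ^~ w)}}.

(* The second argument of [normal_prob] is the standard deviation. *)
Definition brownian_motion {R : realType} {d : measure_display}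
    {T : measurableType d} (P : probability T R) (F : R -> set (set T))
    (W : R -> T -> R) : Prop :=
  [/\ adapted F W,
      {ae P, forall w, W 0 w = 0},
      continuous_paths P W,
      forall s t, 0 <= s -> s < t -> forall B : set R, measurable B ->
        P ((W t \- W s)%R @^-1` B) = normal_prob 0 (Num.sqrt (t - s)) B
    & forall s t, 0 <= s -> s < t -> forall E, F s E ->
        forall B : set R, measurable B ->
        P (E `&` (W t \- W s)%R @^-1` B) =
          (P E * P ((W t \- W s)%R @^-1` B))%E].

(* dX = Y dt, dY = - X dt + alpha dW in integral form; the noise is additive, so
   both equations are pathwise. *)
Definition oscillator_solution {R : realType} {d : measure_display}
    {T : measurableType d} (P : probability T R) (F : R -> set (set T))
    (W : R -> T -> R) (alpha x0 y0 : R) (X Y : R -> T -> R) : Prop :=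
  [/\ adapted F X, adapted F Y, continuous_paths P X, continuous_paths P Y
    & {ae P, forall w, forall t, 0 <= t ->
        X t w = x0 + \int[lebesgue_measure]_(s in `[0, t]) Y s w /\
        Y t w = y0 - \int[lebesgue_measure]_(s in `[0, t]) X s w
                + alpha * W t w}].

Definition oscillator_rate {R : realType} (alpha y : R) : R :=
  y ^+ 2 / alpha ^+ 2.

(** * The numerical method *)

(* The state (x, y) is a column vector: entry [0 0] is x, entry [1 0] is y. *)
Definition vec2 {R : realType} (x y : R) : 'cV[R]_2 :=
  \col_i (if i == 0 then x else y).

Fixpoint method_iter {R : realType} (A : 'M[R]_2) (b : 'cV[R]_2) (alpha : R)
    (dW : nat -> R) (z0 : 'cV[R]_2) (n : nat) : 'cV[R]_2 :=
  if n is m.+1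
  then A *m method_iter A b alpha dW z0 m + (alpha * dW m) *: b
  else z0.

Definition increments {R : realType} {T : Type} (W : R -> T -> R) (h : R)
    (w : T) (n : nat) : R := W (n.+1%:R * h) w - W (n%:R * h) w.

Definition discrete_mean_velocity {R : realType} {T : Type} (A : 'M[R]_2)
    (b : 'cV[R]_2) (alpha x0 y0 h : R) (W : R -> T -> R) (N : nat) (w : T) : R :=
  method_iter A b alpha (increments W h w) (vec2 x0 y0) N 0 0 / (N%:R * h).

(* The 2-form df /\ dg at [p], applied to the tangent vectors [u] and [v]. *)
Definition wedge_diff {R : realType} (f g : 'cV[R]_2 -> R^o)
    (p u v : 'cV[R]_2) : R :=
  'd f p u * 'd g p v - 'd f p v * 'd g p u.

(* dx_{n+1} /\ dy_{n+1} = dx_n /\ dy_n, where for each realization [w] of the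
   noise x_n and y_n are functions of the initial value [z].  Differentiability
   is required because ['d] is arbitrary at points where it fails. *)
Definition symplectic_method {R : realType} {T : Type} (A : 'M[R]_2)
    (b : 'cV[R]_2) (alpha h : R) (W : R -> T -> R) : Prop :=
  forall w : T,
  let x n : 'cV[R]_2 -> R^o :=
    fun z => method_iter A b alpha (increments W h w) z n 0 0 in
  let y n : 'cV[R]_2 -> R^o :=
    fun z => method_iter A b alpha (increments W h w) z n 1 0 in
  (forall n p, differentiable (x n) p /\ differentiable (y n) p) /\
  (forall n p u v,
     wedge_diff (x n.+1) (y n.+1) p u v = wedge_diff (x n) (y n) p u v).

Definition condA1 {R : realType} (A : 'M[R]_2) : Prop :=
  0 < 4 * \det A - (\tr A) ^+ 2.

Definition condA2 {R : realType} (A : 'M[R]_2) : Prop := \det A = 1.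

Definition method_rate {R : realType} (alpha h : R) (A : 'M[R]_2)
    (b : 'cV[R]_2) (y : R) : R :=
  let b1 := b 0 0 in
  let c := A 0 1 * b 1 0 - A 1 1 * b 0 0 in
  h * (4 - (\tr A) ^+ 2) * y ^+ 2
  / (4 * alpha ^+ 2 * ((b1 + c) ^+ 2 - b1 * c * (2 - \tr A))).

(* r(h) = O(h^p) as h -> 0, h > 0. *)
Definition bigO_pow {R : realType} (r : R -> R) (p : nat) : Prop :=
  exists C : R, \forall h \near 0^'+, `|r h| <= C * h ^+ p.

Definition condB {R : realType} (A : R -> 'M[R]_2) (b : R -> 'cV[R]_2) : Prop :=
  bigO_pow (fun h => `|A h 0 0 - 1| + `|A h 1 1 - 1|
                     + `|A h 0 1 - h| + `|A h 1 0 + h|) 2 /\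
  bigO_pow (fun h => `|b h 0 0| + `|b h 1 0 - 1|) 1.

(* [Jh h] is the rate function of the method with step-size [h] for the speed N,
   [Jh h y / h] its modification, and [J] the rate function of [B]. *)
Definition asymptotically_preserves_LDP {R : realType} {d : measure_display}
    {T : measurableType d} (P : probability T R) (B : R -> T -> R)
    (J : R -> R) (Jh : R -> R -> R) : Prop :=
  LDP_good P (pinfty_nbhs R) id B (EFin \o J) /\
  (forall y, Jh h y / h @[h --> 0^'+] --> J y).

(* Main.v *)
(* The 2-form is multiplied by [\det A = 1] at each step, which gives (1).

   For (2), [x_N] is an affine function of independent Gaussian increments,
   hence Gaussian, with mean the first coordinate of [A ^ N z] and variance
   [alpha ^ 2 h \sum_(k < N) p_k ^ 2], where [p_k] is the first coordinate of
   [A ^ k b].  By Cayley-Hamilton both these sequences satisfy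
   [p_(k+2) = \tr A * p_(k+1) - p_k], so that
   [Q = p_(k+1) ^ 2 - \tr A * p_k * p_(k+1) + p_k ^ 2] does not depend on [k];
   by (A1) it is a definite form, the means are bounded and the averages of
   [p_k ^ 2] converge to [2 Q / (4 - (\tr A) ^ 2)].  Thus [B_N] is Gaussian,
   its mean tends to [0] and [N] times its variance tends to some [v > 0]; the
   bounds on Gaussian tails and densities give the rate [y ^ 2 / (2 v)].

   For (3), [\det A = 1] gives [2 - \tr A ~ h ^ 2] under (B), and
   [Q ~ h ^ 2]. *)

Require Import Defs.
From HB Require Import structures.
From mathcomp Require Import all_boot all_order all_algebra.
From mathcomp Require Import all_classical all_reals all_analysis.
From mathcomp Require Import measurable_realfun ring lra.

Import Order.TTheory GRing.Theory Num.Theory.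
Import numFieldNormedType.Exports.

Local Open Scope classical_set_scope.
Local Open Scope ring_scope.

(** * Gaussian laws *)

(** A Radon-Nikodym derivative is determined almost everywhere by its integrals over measurable
    sets, and [normal_pdf] has those integrals by definition of [normal_prob]. *)
Lemma integral_normal_prob (R : realType) (m s : R) (f : R -> \bar R) :
  measurable_fun setT f ->
  (\int[normal_prob m s]_x `|f x| < +oo)%E ->
  (\int[normal_prob m s]_x f x =
   \int[lebesgue_measure]_x (f x * (normal_pdf m s x)%:E))%E.
Proof.
move=> mf finf.
rewrite -(Radon_Nikodym_change_of_variables (normal_prob_dominates m s))//=;
  last by apply/integrableP; split.
apply: ae_eq_integral => //.
- apply: emeasurable_funM => //.
  apply: (measurable_int (@lebesgue_measure R)).
  by apply: Radon_Nikodym_integrable; exact: normal_prob_dominates.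
- by apply: emeasurable_funM => //=; apply/measurableT_comp => //=;
     exact: measurable_normal_pdf.
- apply: ae_eqe_mul2l => /=.
  rewrite Radon_NikodymE//=; first exact: normal_prob_dominates.
  move=> dom; case: cid => /= h [h1 h2 h3].
  apply: integral_ae_eq => //=.
  + by apply/measurableT_comp => //; exact: measurable_normal_pdf.
  + by move=> E _ mE; rewrite -h3.
Qed.

Lemma measurable_affine (R : realType) (c a : R) :
  measurable_fun setT (fun x : R => c * x + a).
Proof. by apply: measurable_funD => //; exact: measurable_funM. Qed.

Lemma measurable_preimage_affine (R : realType) (c a : R) (A : set R) :
  measurable A -> measurable ((fun x => c * x + a) @^-1` A).
Proof. by move=> mA; rewrite -[_ @^-1` _]setTI; exact: measurable_affine. Qed.

(** The right-hand side is a measure in [A] that agrees with length on the intervals []u, v]], so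
    uniqueness of Lebesgue measure applies. For negative [c] the preimage of such an interval is
    closed on the left instead. *)
Lemma lebesgue_measure_affine (R : realType) (c a : R) (A : set R) :
  c != 0 -> measurable A ->
  (lebesgue_measure A =
   `|c|%:E * lebesgue_measure ((fun x => (c * x + a)%R) @^-1` A))%E.
Proof.
move=> c0 mA.
have c1 : 0 < `|c| by rewrite normr_gt0.
pose T : measurableTypeR R -> measurableTypeR R := fun x => c * x + a.
have mT : measurable_fun setT T by exact: measurable_affine.
pose k := NngNum (ltW c1).
pose nu : {measure set (measurableTypeR R) -> \bar R} :=
  mscale k (pushforward lebesgue_measure T).
rewrite (@lebesgue_measure_unique R (nu mT))//.
move=> _ [[u v] _ <-]/=.
rewrite /mscale/= /pushforward.
have [cp|cn] := ltP 0 c.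
  have -> : T @^-1` `]u, v] = `](u - a) / c, (v - a) / c]%classic.
    by apply/seteqP; split => x /=; rewrite !in_itv/= ltr_pdivrMr//
      ler_pdivlMr// ltrBlDr lerBrDr mulrC.
  rewrite !lebesgue_measure_itv/= !lte_fin gtr0_norm//.
  rewrite ltr_pM2r ?invr_gt0// ltrD2r; case: ifPn => _; last by rewrite mule0.
  by rewrite -!EFinB -EFinM; congr (_%:E); field.
have cn' : c < 0 by rewrite lt_neqAle c0.
have -> : T @^-1` `]u, v] = `[(v - a) / c, (u - a) / c[%classic.
  apply/seteqP; split => x /=; rewrite !in_itv/= /T.
    by move=> /andP[? ?]; rewrite ler_ndivrMr// ltr_ndivlMr//
      ltrBlDr lerBrDr mulrC; apply/andP.
  rewrite ler_ndivrMr// ltr_ndivlMr// ltrBlDr lerBrDr mulrC => /andP[? ?].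
  exact/andP.
rewrite !lebesgue_measure_itv/= !lte_fin ltr0_norm//.
rewrite ltr_nM2r ?invr_lt0// ltrD2r; case: ifPn => _; last by rewrite mule0.
by rewrite -!EFinB -EFinM; congr (_%:E); field.
Qed.

Lemma ge0_integral_affine (R : realType) (c a : R) (f : R -> \bar R) :
  c != 0 -> measurable_fun setT f -> (forall x, 0 <= f x)%E ->
  (\int[lebesgue_measure]_x f x =
   `|c|%:E * \int[lebesgue_measure]_x f (c * x + a)%R)%E.
Proof.
move=> c0 mf f0.
have c1 : 0 < `|c| by rewrite normr_gt0.
pose T : measurableTypeR R -> measurableTypeR R := fun x => c * x + a.
have mT : measurable_fun setT T by exact: measurable_affine.
have := @ge0_integral_pushforward _ _ _ _ _ T mT lebesgue_measure setT f
  measurableT mf (fun y _ => f0 y).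
rewrite preimage_setT => /= <-.
pose k := NngNum (ltW c1).
pose nu : {measure set (measurableTypeR R) -> \bar R} :=
  pushforward lebesgue_measure T.
rewrite -(@ge0_integral_mscale _ _ _ (nu mT) setT measurableT k)//.
apply: eq_measure_integral => A mA _.
exact: lebesgue_measure_affine.
Qed.

Lemma normal_peakE (R : realType) (s : R) :
  normal_peak s = (Num.sqrt (pi *+ 2))^-1 / `|s|.
Proof.
by rewrite /normal_peak -mulrnAr (sqrtrM _ (sqr_ge0 s)) sqrtr_sqr invfM mulrC.
Qed.

Lemma sqrt2pi_neq0 (R : realType) : Num.sqrt (pi *+ 2 : R) != 0.
Proof. by rewrite sqrtr_eq0 -ltNge pmulrn_lgt0 ?pi_gt0. Qed.

Lemma normal_pdf_affine (R : realType) (c a m s x : R) : c != 0 -> s != 0 ->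
  normal_pdf m s x = `|c| * normal_pdf (c * m + a) (c * s) (c * x + a).
Proof.
move=> c0 s0; rewrite !normal_pdfE ?mulf_neq0// !normal_peakE normrM [RHS]mulrA.
have cn0 : `|c| != 0 by rewrite normr_eq0.
have sn0 : `|s| != 0 by rewrite normr_eq0.
congr (_ * expR _); field.
  by rewrite sn0 cn0 sqrt2pi_neq0.
by rewrite s0 c0.
Qed.

(** The parameter [c * s] may be negative: a nonzero standard deviation enters [normal_pdf] only
    through its square. *)
Lemma normal_prob_affine (R : realType) (c a m s : R) (B : set R) :
  c != 0 -> s != 0 -> measurable B ->
  normal_prob m s ((fun x => c * x + a) @^-1` B) =
  normal_prob (c * m + a) (c * s) B.
Proof.
move=> c0 s0 mB; rewrite /normal_prob [LHS]integral_mkcond [RHS]integral_mkcond.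
have mphi : measurable_fun setT
    ((fun x => (normal_pdf (c * m + a) (c * s) x)%:E) \_ B).
  apply/(measurable_restrictT _ mB)/measurable_funTS.
  by apply/measurable_EFinP; exact: measurable_normal_pdf.
rewrite [RHS](ge0_integral_affine _ c a)//; last first.
  by apply: erestrict_ge0 => x _; rewrite lee_fin normal_pdf_ge0.
rewrite -ge0_integralZl//; last 2 first.
- by apply: (measurableT_comp mphi); exact: measurable_affine.
- by move=> x _; apply: erestrict_ge0 => y _; rewrite lee_fin normal_pdf_ge0.
apply: eq_integral => x _; rewrite !patchE.
have [Bx|nBx] := pselect (B (c * x + a)).
  by rewrite !mem_set// (normal_pdf_affine _ c a)// EFinM.
by rewrite !memNset// mule0.
Qed.

Lemma normal_prob_norm (R : realType) (m s : R) :
  normal_prob m `|s| = normal_prob m s.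
Proof.
apply/funext => B; rewrite /normal_prob.
apply: eq_integral => x _; have [->|s0] := eqVneq s 0; first by rewrite normr0.
rewrite !normal_pdfE ?normr_eq0// /normal_peak /normal_fun.
by rewrite real_normK ?num_real.
Qed.

(** Completing the square in [x]: the density of the first variable times that of the sum [u] given
    [x] is the density of the sum times that of [x] given [u]. The last factor is again Gaussian, so
    it integrates to 1 in [x]. *)
Lemma normal_pdfM (R : realType) (m s n t x u : R)
    (r := Num.sqrt (s ^+ 2 + t ^+ 2)) :
  s != 0 -> t != 0 ->
  normal_pdf m s x * normal_pdf (x + n) t u =
  normal_pdf (m + n) r u *
  normal_pdf ((m * t ^+ 2 + (u - n) * s ^+ 2) / r ^+ 2) (s * t / r) x.
Proof.
move=> s0 t0.
have s2 : 0 < s ^+ 2 by rewrite exprn_even_gt0.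
have t2 : 0 < t ^+ 2 by rewrite exprn_even_gt0.
have r2 : r ^+ 2 = s ^+ 2 + t ^+ 2 by rewrite sqr_sqrtr// addr_ge0// ltW.
have st0 : 0 < s ^+ 2 + t ^+ 2 by rewrite addr_gt0.
have r0 : r != 0 by rewrite sqrtr_eq0 -ltNge.
rewrite !normal_pdfE ?mulf_neq0 ?invr_eq0//.
rewrite mulrACA [RHS]mulrACA; congr (_ * _).
  have sn0 : `|s| != 0 by rewrite normr_eq0.
  have tn0 : `|t| != 0 by rewrite normr_eq0.
  have rn0 : `|r| != 0 by rewrite normr_eq0.
  rewrite !normal_peakE !normrM normfV; field.
  by rewrite rn0 tn0 sn0 sqrt2pi_neq0.
rewrite /normal_fun -!expRD; congr expR.
rewrite !exprMn exprVn r2; field.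
by rewrite t0 s0 lt0r_neq0.
Qed.

(** The sections of the event are events for a shifted Gaussian; after Tonelli the inner integral
    runs over [x], and [normal_pdfM] evaluates it. *)
Lemma normal_prob_convolution (R : realType) (m s n t : R) (B : set R) :
  s != 0 -> t != 0 -> measurable B ->
  (normal_prob m s \x normal_prob n t)%E [set z | B (z.1 + z.2)] =
  normal_prob (m + n) (Num.sqrt (s ^+ 2 + t ^+ 2)) B.
Proof.
move=> s0 t0 mB; set r := Num.sqrt _.
have r0 : r != 0 by rewrite sqrtr_eq0 -ltNge addr_gt0// exprn_even_gt0.
have mA : measurable [set z : R * R | B (z.1 + z.2)].
  rewrite -[X in measurable X]setTI.
  exact: (measurable_funD measurable_fst measurable_snd).
have secE x : normal_prob n t (xsection [set z : R * R | B (z.1 + z.2)] x) =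
    normal_prob (x + n) t B.
  rewrite -[in RHS](mul1r n) -[in RHS](mul1r t) (addrC x).
  rewrite -normal_prob_affine ?oner_eq0//; congr normal_prob.
  apply/seteqP; split => y; rewrite /xsection/= ?inE/= mul1r addrC//.
rewrite /product_measure1 integral_normal_prob; last 2 first.
- exact: measurable_fun_xsection.
- apply: (@le_lt_trans _ _ (\int[normal_prob m s]_x cst 1 x)%E).
    apply: ge0_le_integral => //.
    + by apply: measurableT_comp => //; exact: measurable_fun_xsection.
    + move=> x _; rewrite gee0_abs//=.
      by rewrite probability_le1//; exact: measurable_xsection.
  by rewrite integral_cst//= mul1e probability_setT ltry.
have shift x u : normal_pdf (x + n) t u = normal_pdf n t (u - x).
  rewrite !normal_pdfE// /normal_fun; congr (_ * expR _).
  by rewrite opprD addrA.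
(* The mean [x] is moved into the argument of the density, which makes measurability in the pair
   visible. *)
pose f (z : R * R) :=
  (normal_pdf m s z.1 * normal_pdf n t (z.2 - z.1) * \1_B z.2)%:E.
have mf : measurable_fun setT f.
  apply/measurable_EFinP/measurable_funM; last first.
    by apply: measurableT_comp => //; exact: measurable_indic.
  apply: measurable_funM.
    by apply: measurableT_comp => //; exact: measurable_normal_pdf.
  apply: measurableT_comp; first exact: measurable_normal_pdf.
  exact: measurable_funB.
have f0 z : (0 <= f z)%E.
  by rewrite lee_fin !mulr_ge0// normal_pdf_ge0.
transitivity (\int[lebesgue_measure]_x \int[lebesgue_measure]_u f (x, u))%E.
  apply: eq_integral => x _ /=.
  rewrite secE /normal_prob muleC -ge0_integralZl//.
  - rewrite integral_mkcond; apply: eq_integral => u _.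
    rewrite /f patchE /= indicE -shift.
    case: ifPn => _; first by rewrite mulr1 EFinM.
    by rewrite mulr0.
  - apply: measurable_funTS; apply/measurable_EFinP.
    exact: measurable_normal_pdf.
  - by move=> ? _; rewrite lee_fin normal_pdf_ge0.
  - by rewrite lee_fin normal_pdf_ge0.
rewrite (@fubini_tonelli _ _ _ _ _ lebesgue_measure lebesgue_measure f)//.
rewrite /normal_prob [RHS]integral_mkcond; apply: eq_integral => u _.
rewrite patchE /f/= indicE; case: ifPn => _; last first.
  by under eq_integral do rewrite mulr0; rewrite integral0.
under eq_integral do rewrite mulr1 -shift normal_pdfM// EFinM.
rewrite ge0_integralZl//.
- by rewrite integral_normal_pdf mule1.
- by apply/measurable_EFinP; exact: measurable_normal_pdf.
- by move=> ? _; rewrite lee_fin normal_pdf_ge0.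
- by rewrite lee_fin normal_pdf_ge0.
Qed.

(** Independence gives the joint law on rectangles, and these determine it as the product
    measure. *)
Lemma probability_normalD (R : realType) (d : measure_display)
    (T : measurableType d) (P : probability T R) (X Y : T -> R) (m s n t : R) :
  measurable_fun setT X -> measurable_fun setT Y -> s != 0 -> t != 0 ->
  (forall B, measurable B -> P (X @^-1` B) = normal_prob m s B) ->
  (forall B, measurable B -> P (Y @^-1` B) = normal_prob n t B) ->
  (forall A B, measurable A -> measurable B ->
    P (X @^-1` A `&` Y @^-1` B) = (P (X @^-1` A) * P (Y @^-1` B))%E) ->
  forall B, measurable B ->
  P ((fun w => X w + Y w) @^-1` B) =
  normal_prob (m + n) (Num.sqrt (s ^+ 2 + t ^+ 2)) B.
Proof.
move=> mX mY s0 t0 lawX lawY indep B mB.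
rewrite -normal_prob_convolution//.
pose XY w : measurableTypeR R * measurableTypeR R := (X w, Y w).
have mXY : measurable_fun setT XY by exact/measurable_fun_pairP.
pose nu : {measure set (measurableTypeR R * measurableTypeR R) -> \bar R} :=
  pushforward P XY.
apply/esym; apply: (@product_measure_unique _ _ _ _ _
  (normal_prob m s) (normal_prob n t) (nu mXY)).
- by move=> A C mA mC; rewrite /nu/= -lawX// -lawY// -indep.
- rewrite -[X in measurable X]setTI.
  exact: (measurable_funD measurable_fst measurable_snd).
Qed.

(** On [A] the cross term in [(x - m)^2 = (x - r)^2 + (r - m)^2 + 2 (x - r) (r - m)] is nonnegative.
    The density is therefore at most [normal_fun m s r] times the density centred at [r], whose
    total mass is 1. *)
Lemma normal_prob_le_normal_fun (R : realType) (m s r : R) (A : set R) :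
  s != 0 -> measurable A -> (forall x, A x -> 0 <= (x - r) * (r - m)) ->
  (normal_prob m s A <= (normal_fun m s r)%:E)%E.
Proof.
move=> s0 mA Ar.
have mphi a : measurable_fun setT (fun x => (normal_pdf a s x)%:E).
  by apply/measurable_EFinP; exact: measurable_normal_pdf.
rewrite -[leRHS]mule1 -(integral_normal_pdf r s).
rewrite -ge0_integralZl//; last 3 first.
- exact: mphi.
- by move=> x _; rewrite lee_fin normal_pdf_ge0.
- by rewrite lee_fin normal_fun_ge0.
rewrite /normal_prob; apply: (@le_trans _ _
  (\int[lebesgue_measure]_(x in A)
    ((normal_fun m s r)%:E * (normal_pdf r s x)%:E))%E).
  apply: ge0_le_integral => //.
  - by move=> x _; rewrite lee_fin normal_pdf_ge0.
  - by apply: measurable_funTS; exact: mphi.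
  - by apply: measurable_funTS; apply: emeasurable_funM => //; exact: mphi.
  - move=> x Ax; rewrite -EFinM lee_fin !normal_pdfE// mulrCA.
    rewrite ler_wpM2l ?normal_peak_ge0// /normal_fun -expRD ler_expR.
    rewrite -mulrDl ler_wpM2r ?invr_ge0 ?mulrn_wge0 ?sqr_ge0//.
    have := Ar x Ax; lra.
apply: ge0_subset_integral => //.
- by apply: emeasurable_funM => //; exact: mphi.
- move=> x _; rewrite -EFinM lee_fin.
  by rewrite mulr_ge0// ?normal_fun_ge0 ?normal_pdf_ge0.
Qed.

(** [A] lies in two half-lines, whose end points [r] and [- r] are both at distance at least [r]
    minus the absolute value of [m] from [m]; each half-line contributes one exponential. *)
Lemma normal_prob_tail (R : realType) (m s r : R) (A : set R) :
  s != 0 -> measurable A -> `|m| <= r -> (forall x, A x -> r <= `|x|) ->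
  (normal_prob m s A <= (2 * expR (- (r - `|m|) ^+ 2 / (s ^+ 2 *+ 2)))%:E)%E.
Proof.
move=> s0 mA mr Ar.
have [mr1 mr2] : m <= r /\ - m <= r.
  by split; apply: le_trans mr; rewrite ?ler_norm// -normrN ler_norm.
have mle : m <= `|m| /\ - m <= `|m| by rewrite ler_norm -normrN ler_norm.
have AE : A `<=` (A `&` `[r, +oo[) `|` (A `&` `]-oo, -r]).
  move=> x Ax; have [x0|x0] := leP 0 x; [left|right]; split => //=.
    by rewrite in_itv/= andbT -(ger0_norm x0) Ar.
  by rewrite in_itv/= lerNr -(ltr0_norm x0) Ar.
have mI (i : interval R) : measurable (A `&` [set` i]) by exact: measurableI.
apply: (@le_trans _ _ (normal_prob m s (A `&` `[r, +oo[) +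
                       normal_prob m s (A `&` `]-oo, (- r)%R]))%E).
  apply: (@le_trans _ _ (normal_prob m s
      ((A `&` `[r, +oo[) `|` (A `&` `]-oo, (- r)%R])))).
    by apply: le_measure; rewrite ?inE//; apply: measurableU; exact: mI.
  by apply: measureU2; exact: mI.
rewrite (_ : 2 = 1 + 1)// mulrDl mul1r EFinD leeD//.
  apply: (le_trans (normal_prob_le_normal_fun _ m s r _ s0 _ _)) => //.
    move=> x [_]/=; rewrite in_itv/= andbT => rx.
    by rewrite mulr_ge0// subr_ge0.
  rewrite lee_fin ler_expR ler_wpM2r ?invr_ge0 ?mulrn_wge0 ?sqr_ge0//.
  by rewrite lerN2 ler_sqr ?nnegrE ?subr_ge0// lerB//; case: mle.
apply: (le_trans (normal_prob_le_normal_fun _ m s (- r) _ s0 _ _)) => //.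
  move=> x [_]/=; rewrite in_itv/= => rx.
  by rewrite mulr_le0// ?subr_le0// lerNl.
rewrite lee_fin ler_expR ler_wpM2r ?invr_ge0 ?mulrn_wge0 ?sqr_ge0//.
have -> : (- r - m) ^+ 2 = (r + m) ^+ 2 by ring.
case: mle => _ mle; rewrite lerN2 ler_sqr ?nnegrE; lra.
Qed.

Lemma normal_prob_itv_ge (R : realType) (m s rho a b : R) :
  s != 0 -> a <= b -> (forall x, x \in `[a, b] -> `|x - m| <= rho) ->
  (((b - a) * (normal_peak s * expR (- rho ^+ 2 / (s ^+ 2 *+ 2))))%:E <=
   normal_prob m s `[a, b])%E.
Proof.
move=> s0 ab abr; set k := normal_peak s * _.
have k0 : 0 <= k by rewrite mulr_ge0 ?normal_peak_ge0 ?expR_ge0.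
have -> : ((b - a) * k)%:E =
    (\int[lebesgue_measure]_(x in `[a, b]) cst k%:E x)%E.
  rewrite integral_cst//= lebesgue_measure_itv/= lte_fin mulrC EFinM.
  move: ab; rewrite le_eqVlt => /predU1P[->|ab]; last by rewrite ab EFinB.
  by rewrite ltxx subrr.
apply: ge0_le_integral => //.
- apply: measurable_funTS; apply/measurable_EFinP; exact: measurable_normal_pdf.
- move=> x /= xab; rewrite lee_fin normal_pdfE// ler_wpM2l ?normal_peak_ge0//.
  rewrite ler_expR ler_wpM2r ?invr_ge0 ?mulrn_wge0 ?sqr_ge0//.
  rewrite lerN2 -real_normK ?num_real// lerXn2r ?nnegrE ?abr//.
  exact: le_trans (abr _ xab).
Qed.

(** * Large deviations of Gaussian sequences *)

Lemma limf_esup_le_near (R : realType) (K : topologicalType) (F : set_system K)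
    (f : K -> \bar R) (c : \bar R) :
  (\forall k \near F, (f k <= c)%E) -> (limf_esup f F <= c)%E.
Proof.
move=> fc; rewrite limf_esupE.
apply: (@le_trans _ _ (ereal_sup (f @` [set k | (f k <= c)%E]))).
  by apply: ereal_inf_lbound; exists [set k | (f k <= c)%E].
by apply: ub_ereal_sup => _ [k kc <-].
Qed.

Lemma limf_esup_le_cvg (R : realType) (K : topologicalType) (F : set_system K)
    {FF : Filter F} (f : K -> \bar R) (g : K -> R) (l : R) :
  g @ F --> l -> (\forall k \near F, (f k <= (g k)%:E)%E) ->
  (limf_esup f F <= l%:E)%E.
Proof.
move=> gl fg; apply/lee_addgt0Pr => e e0; apply: limf_esup_le_near.
have gle : \forall k \near F, g k < l + e.
  by apply: (cvgr_lt l gl); rewrite ltrDl.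
near=> k; apply: (@le_trans _ _ (g k)%:E); first by near: k.
by rewrite -EFinD lee_fin ltW//; near: k.
Unshelve. all: by end_near. Qed.

Lemma limf_einf_ge_cvg (R : realType) (K : topologicalType) (F : set_system K)
    {FF : Filter F} (f : K -> \bar R) (g : K -> R) (l : R) :
  g @ F --> l -> (\forall k \near F, ((g k)%:E <= f k)%E) ->
  (l%:E <= limf_einf f F)%E.
Proof.
move=> gl gf; rewrite /limf_einf leeNr -EFinN.
apply: (@limf_esup_le_cvg _ _ _ _ _ (fun k => - g k)); first exact: cvgN.
by apply: filterS gf => k gfk; rewrite EFinN leeN2.
Qed.

Lemma good_rate_function_quadratic (R : realType) (c : R) :
  0 < c -> good_rate_function (fun y : R => (c * y ^+ 2)%:E).
Proof.
move=> c0.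
have cont : continuous (fun y : R => c * y ^+ 2).
  by move=> y; apply: cvgM; [exact: cvg_cst|exact: exprn_continuous].
split.
- move=> x a; rewrite lte_fin => ax.
  exists [set y | a < c * y ^+ 2]; last by move=> y; rewrite lte_fin.
  exact: (cvgr_gt (c * x ^+ 2) (cont x)).
- by move=> y; rewrite lee_fin mulr_ge0 ?sqr_ge0// ltW.
- move=> a a0.
  have -> : [set y | ((c * y ^+ 2)%:E <= a%:E)%E] =
      `[- Num.sqrt (a / c), Num.sqrt (a / c)]%classic.
    apply/funext => y /=; apply/propext; rewrite in_itv/= -ler_norml lee_fin.
    by rewrite mulrC -ler_pdivlMr// -sqrtr_sqr ler_sqrt// divr_ge0// ltW.
  exact: segment_compact.
Qed.

Section gaussian_LDP.
Context (R : realType) (d : measure_display) (T : measurableType d)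
  (P : probability T R) (Z : nat -> T -> R) (m s : nat -> R) (v : R).
Hypotheses (v0 : 0 < v) (m0 : m n @[n --> \oo] --> 0)
  (sv : n%:R * s n ^+ 2 @[n --> \oo] --> v)
  (lawZ : \forall n \near \oo, forall B, measurable B ->
    P (Z n @^-1` B) = normal_prob (m n) (s n) B).

Let s_neq0 : \forall n \near \oo, s n != 0.
Proof.
have : \forall n \near \oo, 0 < n%:R * s n ^+ 2 by exact: (cvgr_gt v sv).
by apply: filterS => n; case: eqVneq => // ->; rewrite expr0n/= mulr0 ltxx.
Qed.

Let harmonic0 : n%:R^-1 @[n --> \oo] --> (0 : R).
Proof. by rewrite -cvg_shiftS; exact: cvg_harmonic. Qed.

(** The variances [s n ^+ 2] tend to 0, so the peaks grow without bound, and the lower bound on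
    probabilities may replace the peak by 1. *)
Let normal_peak_ge1 : \forall n \near \oo, 1 <= normal_peak (s n).
Proof.
have : n%:R^-1 * (n%:R * s n ^+ 2) @[n --> \oo] --> 0 * v by exact: cvgM.
rewrite mul0r => s20.
have pi2 : 0 < pi *+ 2 :> R by rewrite mulrn_wgt0// pi_gt0.
near=> n.
have n0 : (0 < n)%N by near: n; exact: nbhs_infty_gt.
have sn0 : s n != 0 by near: n.
have : n%:R^-1 * (n%:R * s n ^+ 2) < (pi *+ 2)^-1.
  by near: n; apply: (cvgr_lt 0 s20); rewrite invr_gt0.
rewrite mulKf ?pnatr_eq0 -?lt0n// => sn.
have sp : 0 < s n ^+ 2 * (pi *+ 2) by rewrite pmulr_lgt0// exprn_even_gt0.
rewrite /normal_peak -mulrnAr invf_ge1 ?sqrtr_gt0//.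
by rewrite -sqrtr1 ler_sqrt// -ler_pdivlMr// div1r ltW.
Unshelve. all: by end_near. Qed.

Let normm0 : `|m n| @[n --> \oo] --> 0.
Proof. by rewrite -(@normr0 _ R); apply: cvg_norm. Qed.

Let esup_le (r : R) (C : set R) : measurable C -> 0 <= r ->
  (forall y, C y -> r <= `|y|) ->
  (limf_esup (fun n => (n%:R)^-1%:E * lne (P (Z n @^-1` C))) \oo <=
   (- ((v *+ 2)^-1 * r ^+ 2))%:E)%E.
Proof.
(* The tail bound asks for a mean of absolute value at most [r], which is guaranteed eventually when
   [r > 0]. For [r = 0] the claim is that logarithms of probabilities are nonpositive. *)
move=> mC; rewrite le_eqVlt => /predU1P[<- _|r0 Cr].
  rewrite expr0n/= mulr0 oppr0; apply: limf_esup_le_near.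
  near=> n; rewrite mule_ge0_le0//.
  rewrite lne_le0.
  have -> : P (Z n @^-1` C) = normal_prob (m n) (s n) C.
    by have H : forall B, measurable B ->
         P (Z n @^-1` B) = normal_prob (m n) (s n) B; [near: n|exact: H].
  exact: probability_le1.
(* This is the logarithm of the tail bound divided by [n]; the prefactor 2 disappears in the
   limit. *)
pose g n := n%:R^-1 * ln 2 - (r - `|m n|) ^+ 2 / ((n%:R * s n ^+ 2) *+ 2).
apply: (@limf_esup_le_cvg _ _ _ _ _ g).
  rewrite -[X in _ --> X]add0r /g -(mul0r (ln 2)); apply: cvgB.
    by apply: cvgM => //; exact: cvg_cst.
  rewrite mulrC; apply: cvgM.
    rewrite -[X in X ^+ 2]subr0.
    apply: (@cvg_comp _ _ _ (fun n => r - `|m n|) (fun x => x ^+ 2));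
      last exact: exprn_continuous.
    by apply: cvgB => //; exact: cvg_cst.
  apply: cvgV; first by rewrite lt0r_neq0// mulrn_wgt0.
  exact: cvgMn.
near=> n.
have n0 : (0 < n)%N by near: n; exact: nbhs_infty_gt.
have sn0 : s n != 0 by near: n.
have mr : `|m n| < r by near: n; exact: (cvgr_lt 0 normm0).
have PE : P (Z n @^-1` C) = normal_prob (m n) (s n) C.
  by have H : forall B, measurable B ->
       P (Z n @^-1` B) = normal_prob (m n) (s n) B; [near: n|exact: H].
have tail := normal_prob_tail _ _ _ _ _ sn0 mC (ltW mr) Cr.
rewrite PE.
apply: (@le_trans _ _ ((n%:R^-1)%:E *
    lne (2 * expR (- (r - `|m n|) ^+ 2 / (s n ^+ 2 *+ 2)))%:E)%E).
  apply: lee_wpmul2l; first by rewrite lee_fin invr_ge0.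
  by rewrite lee_lne// in_itv/= leey andbT ?measure_ge0.
rewrite lne_EFin ?mulr_gt0 ?expR_gt0// lnM ?posrE ?expR_gt0// expRK.
rewrite -EFinM lee_fin /g mulrDr lerD2l le_eqVlt; apply/orP; left; apply/eqP.
by field; rewrite sn0 pnatr_eq0 -lt0n.
Unshelve. all: by end_near. Qed.

(** A short interval in [U] starting at [y] suffices: its length does not depend on [n], so it is
    negligible on the exponential scale, and the loss [e] due to its width is removed by letting [e]
    tend to 0. *)
Let einf_ge (y : R) (U : set R) : open U -> U y ->
  ((- ((v *+ 2)^-1 * y ^+ 2))%:E <=
   limf_einf (fun n => (n%:R)^-1%:E * lne (P (Z n @^-1` U))) \oo)%E.
Proof.
move=> oU Uy.
have mU : measurable U by exact: open_measurable.
have near_le (e : R) : 0 < e -> (((- ((v *+ 2)^-1 * (`|y| + e) ^+ 2))%:E <=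
   limf_einf (fun n => (n%:R)^-1%:E * lne (P (Z n @^-1` U))) \oo))%E.
  move=> e0.
  have /nbhs_ballP[e1/= e10 ballU] : nbhs y U by exact: open_nbhs_nbhs.
  (* The bound [e] limits the distance to [y]; half of [e1] keeps the closed right end inside the
     open ball. *)
  pose dl := Num.min e (e1 / 2).
  have dl0 : 0 < dl by rewrite lt_min e0 divr_gt0.
  have dle : dl <= e by rewrite ge_min lexx.
  have itvU : `[y, y + dl]%classic `<=` U.
    move=> x /=; rewrite in_itv/= => /andP[yx xy]; apply: ballU.
    rewrite /ball/= ltr_distl; apply/andP; split; last lra.
    have : dl <= e1 / 2 by rewrite ge_min lexx orbT.
    lra.
  pose g n := n%:R^-1 * ln dl -
    (`|y| + e + `|m n|) ^+ 2 / ((n%:R * s n ^+ 2) *+ 2).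
  apply: (@limf_einf_ge_cvg _ _ _ _ _ g).
    rewrite -[X in _ --> X]add0r /g -(mul0r (ln dl)); apply: cvgB.
      by apply: cvgM => //; exact: cvg_cst.
    rewrite mulrC; apply: cvgM.
      rewrite -[X in X ^+ 2]addr0.
      apply: (@cvg_comp _ _ _ (fun n => `|y| + e + `|m n|) (fun x => x ^+ 2));
        last exact: exprn_continuous.
      by apply: cvgD => //; exact: cvg_cst.
    apply: cvgV; first by rewrite lt0r_neq0// mulrn_wgt0.
    exact: cvgMn.
  near=> n.
  have n0 : (0 < n)%N by near: n; exact: nbhs_infty_gt.
  have sn0 : s n != 0 by near: n.
  have peak1 : 1 <= normal_peak (s n).
    by near: n.
  have PE : P (Z n @^-1` U) = normal_prob (m n) (s n) U.
    by have H : forall B, measurable B ->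
      P (Z n @^-1` B) = normal_prob (m n) (s n) B; [near: n|exact: H].
  rewrite PE.
  pose h := - (`|y| + e + `|m n|) ^+ 2 / (s n ^+ 2 *+ 2).
  apply: (@le_trans _ _ ((n%:R^-1)%:E * lne (dl * expR h)%:E)%E).
    rewrite lne_EFin ?mulr_gt0 ?expR_gt0// lnM ?posrE ?expR_gt0// expRK.
    rewrite -EFinM lee_fin /g mulrDr lerD2l le_eqVlt.
    apply/orP; left; apply/eqP.
    by rewrite /h; field; rewrite sn0 pnatr_eq0 -lt0n.
  apply: lee_wpmul2l; first by rewrite lee_fin invr_ge0.
  rewrite lee_lne ?in_itv/= ?leey ?andbT ?measure_ge0//; last first.
    by rewrite lee_fin mulr_ge0 ?expR_ge0// ltW.
  apply: (@le_trans _ _ (normal_prob (m n) (s n) `[y, y + dl]%classic));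
    last first.
    by apply: le_measure => //; rewrite inE.
  apply: le_trans
    (normal_prob_itv_ge _ _ _ (`|y| + e + `|m n|) _ _ sn0 _ _).
  - rewrite lee_fin addrAC subrr add0r ler_wpM2l ?(ltW dl0)// /h.
    by rewrite ler_peMl ?expR_ge0.
  - by rewrite lerDl ltW.
  - move=> x; rewrite in_itv/= => /andP[yx xy].
    apply: (le_trans (ler_normB _ _)); rewrite lerD2r.
    have -> : x = y + (x - y) by ring.
    apply: (le_trans (ler_normD _ _)); rewrite lerD2l ger0_norm ?subr_ge0//.
    by lra.
have cvge : - ((v *+ 2)^-1 * (`|y| + e) ^+ 2) @[e --> 0^'+] -->
    - ((v *+ 2)^-1 * y ^+ 2).
  rewrite -[y ^+ 2]real_normK ?num_real// -[X in X ^+ 2 ]addr0.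
  apply: cvg_at_right_filter; apply: cvgN; apply: cvgM; first exact: cvg_cst.
  apply: (@cvg_comp _ _ _ (fun e => `|y| + e) (fun x => x ^+ 2));
    last exact: exprn_continuous.
  by apply: cvgD; [exact: cvg_cst|exact: cvg_id].
apply/lee_subgt0Pr => e e0.
have [e1 [e10 e1lt]] : exists e1 : R, 0 < e1 /\
    - ((v *+ 2)^-1 * y ^+ 2) - e < - ((v *+ 2)^-1 * (`|y| + e1) ^+ 2).
  near (0 : R)^'+ => e1; exists e1.
  split; first by near: e1; exact: nbhs_right_gt.
  near: e1; apply: (cvgr_gt _ cvge); by rewrite ltrBlDr ltrDl.
apply: (le_trans _ (near_le e1 e10)).
by rewrite -EFinB lee_fin ltW.
Unshelve. all: by end_near. Qed.

Lemma gaussian_LDP :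
  LDP P \oo (fun n => n%:R) Z (fun y => ((v *+ 2)^-1 * y ^+ 2)%:E).
Proof.
set I := (X in LDP _ _ _ _ X).
have c0 : 0 < (v *+ 2)^-1 by rewrite invr_gt0 mulrn_wgt0.
split=> [U oU|C cC].
  rewrite leeNl; apply: le_ereal_inf_tmp => _ [y Uy <-].
  by rewrite leeNl -EFinN; exact: einf_ge.
have mC : measurable C by exact: closed_measurable.
set L := limf_esup _ _.
(* Any lower bound [a] of the rate on [C] is allowed, so that an infinite infimum can be treated by
   varying [a]. The radius [Num.sqrt (a * (v *+ 2))] is where the rate equals [a]. *)
have le_inf (a : R) : 0 <= a ->
    (a%:E <= ereal_inf (I @` C))%E -> (L <= (- a)%:E)%E.
  move=> a0 aI.
  have -> : a = (v *+ 2)^-1 * (Num.sqrt (a * (v *+ 2))) ^+ 2.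
    rewrite sqr_sqrtr; last by rewrite mulr_ge0// mulrn_wge0// ltW.
    by rewrite mulrC mulfK// lt0r_neq0// mulrn_wgt0.
  apply: esup_le => // y Cy; rewrite -sqrtr_sqr ler_sqrt ?sqr_ge0//.
  rewrite -ler_pdivlMr ?mulrn_wgt0// mulrC.
  by rewrite -lee_fin; apply: (le_trans aI); apply: ereal_inf_lbound; exists y.
case infE : (ereal_inf (I @` C)) => [r| |].
- rewrite -EFinN; apply: le_inf; last by rewrite infE.
  rewrite -lee_fin -infE; apply: le_ereal_inf_tmp => _ [y _ <-].
  by rewrite lee_fin mulr_ge0 ?sqr_ge0// ltW.
(* Here [C] is empty. Taking [a = 0] excludes that [L] is [+oo], and taking [a] larger than the
   absolute value of [l] excludes a real value [l]. *)
- case LE : L => [l| |] //; last first.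
    by have := le_inf 0 (lexx 0); rewrite infE leey LE => /(_ isT).
  exfalso; have := le_inf (`|l| + 1); rewrite infE leey LE => /(_ _ isT).
  rewrite lee_fin addr_ge0// => /(_ isT); have := ler_norm (- l).
  by rewrite normrN; lra.
- by rewrite leey.
Qed.

End gaussian_LDP.

(** * Linear recurrences of order two *)

Section mx2.
Context (R : comRingType).
Implicit Types (A : 'M[R]_2) (z : 'cV[R]_2).

Let lift01 : lift ord0 ord0 = 1 :> 'I_2.
Proof. exact: val_inj. Qed.

Lemma mulmx2E A z i : (A *m z) i 0 = A i 0 * z 0 0 + A i 1 * z 1 0.
Proof. by rewrite mxE big_ord_recl big_ord1 lift01. Qed.

Lemma mxtrace2 A : \tr A = A 0 0 + A 1 1.
Proof. by rewrite /mxtrace big_ord_recl big_ord1 lift01. Qed.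

Lemma det2 A : \det A = A 0 0 * A 1 1 - A 0 1 * A 1 0.
Proof.
rewrite (expand_det_row _ ord0) big_ord_recl big_ord1 /cofactor !det_mx11 !mxE.
rewrite lift01 (_ : lift 1 0 = 0); last exact: val_inj.
by rewrite expr0 expr1 mul1r mulN1r mulrN.
Qed.

(* Cayley-Hamilton: [A ^ 2 = \tr A * A - \det A]. *)
Lemma iter_mulmx2_rec A z k i :
  iter k.+2 (mulmx A) z i 0 =
  \tr A * iter k.+1 (mulmx A) z i 0 - \det A * iter k (mulmx A) z i 0.
Proof.
rewrite mxtrace2 det2 !iterS !mulmx2E.
have := ltn_ord i; case: i => [[|[|//]] Hi] _.
  rewrite (_ : Ordinal Hi = 0); last exact: val_inj.
  ring.
rewrite (_ : Ordinal Hi = 1); last exact: val_inj.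
ring.
Qed.

End mx2.

Lemma cvg_invn_bounded (R : realType) (u : nat -> R) (C : R) :
  (forall n, `|u n| <= C) ->
  n%:R^-1 * u n @[n --> \oo] --> 0.
Proof.
move=> uC.
have h0 : n%:R^-1 * C @[n --> \oo] --> 0.
  rewrite -[X in _ --> X](mul0r C); apply: cvgM; last exact: cvg_cst.
  by rewrite -cvg_shiftS; exact: cvg_harmonic.
apply/norm_cvg0P.
apply: (squeeze_cvgr _ (cvg_cst 0) h0); apply: nearW => n.
by rewrite normr_ge0/= normrM ger0_norm ?invr_ge0// ler_wpM2l// invr_ge0.
Qed.

Section elliptic_recurrence.
Context (R : realType) (tau : R) (p : nat -> R).
Hypotheses (tau4 : 0 < 4 - tau ^+ 2)
  (pS : forall k, p k.+2 = tau * p k.+1 - p k).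

Let Q := p 1 ^+ 2 - tau * p 0 * p 1 + p 0 ^+ 2.

Lemma elliptic_invariant k : p k.+1 ^+ 2 - tau * p k * p k.+1 + p k ^+ 2 = Q.
Proof. by elim: k => [//|k <-]; rewrite pS; ring. Qed.

(** Completing the square: [4 * Q - (4 - tau ^+ 2) * p k ^+ 2] is the square of
    [2 * p k.+1 - tau * p k]. *)
Lemma elliptic_bound k : `|p k| <= Num.sqrt (4 * Q / (4 - tau ^+ 2)).
Proof.
rewrite -sqrtr_sqr ler_wsqrtr// ler_pdivlMr// -(elliptic_invariant k) -subr_ge0.
rewrite (_ : _ - _ = (2 * p k.+1 - tau * p k) ^+ 2); last by ring.
exact: sqr_ge0.
Qed.

(* The remainder is the unique (up to the invariant) quadratic form in
   [(p n, p n.+1)] whose increments are [p n ^+ 2] minus its average. *)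
Lemma elliptic_sum_sqr n (kappa := 2 / (4 - tau ^+ 2))
    (g := fun n => (kappa - 1) * p n ^+ 2 - kappa * tau / 2 * p n * p n.+1) :
  \sum_(k < n) p k ^+ 2 = n%:R * (kappa * Q) + g n - g 0.
Proof.
elim: n => [|n IH]; first by rewrite big_ord0 mul0r add0r subrr.
rewrite big_ord_recr /= IH -(natr1 n) mulrDl mul1r /g.
rewrite -(elliptic_invariant n) pS /kappa; field.
exact: lt0r_neq0.
Qed.

(** By [elliptic_bound] the remainder [g n - g 0] of [elliptic_sum_sqr] stays bounded, so only the
    linear term survives division by [n]. *)
Lemma elliptic_average_sqr :
  n%:R^-1 * (\sum_(k < n) p k ^+ 2) @[n --> \oo] --> 2 / (4 - tau ^+ 2) * Q.
Proof.
set kappa := 2 / _.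
pose g n := (kappa - 1) * p n ^+ 2 - kappa * tau / 2 * p n * p n.+1.
set M := Num.sqrt (4 * Q / (4 - tau ^+ 2)).
have gb n : `|g n - g 0| <=
    (`|kappa - 1| * M ^+ 2 + `|kappa * tau / 2| * M * M) *+ 2.
  have gb1 k : `|g k| <= `|kappa - 1| * M ^+ 2 + `|kappa * tau / 2| * M * M.
    have pM j : `|p j| <= M by exact: elliptic_bound.
    apply: (le_trans (ler_normB _ _)); apply: lerD.
      by rewrite normrM ler_wpM2l// normrX lerXn2r ?nnegrE// sqrtr_ge0.
    rewrite normrM ler_pM// normrM ler_pM//.
  by rewrite mulr2n; apply: (le_trans (ler_normB _ _)); rewrite lerD.
rewrite -[X in _ --> X]addr0.
have : (kappa * Q + n%:R^-1 * (g n - g 0)) @[n --> \oo] --> kappa * Q + 0.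
  by apply: cvgD; [exact: cvg_cst|exact: cvg_invn_bounded gb].
apply: cvg_trans; apply: near_eq_cvg; near=> n.
have n0 : (0 < n)%N by near: n; exact: nbhs_infty_gt.
rewrite elliptic_sum_sqr -/kappa -[in RHS]addrA [RHS]mulrDr mulKf//.
by rewrite pnatr_eq0 -lt0n.
Unshelve. all: by end_near. Qed.

End elliptic_recurrence.

(** * Sums of Brownian increments *)

(** With [G] taken as the measurable structure on [T], this is stability of measurable functions
    under sums and multiples; [sigma_algebra_id] leads back from the generated sigma-algebra to
    [G]. *)
Lemma sigma_algebra_preimageDM (R : realType) (d : measure_display)
    (T : measurableType d) (G : set (set T)) (X Y : T -> R) (c : R) :
  sigma_algebra setT G ->
  (forall B, measurable B -> G (X @^-1` B)) ->
  (forall B, measurable B -> G (Y @^-1` B)) ->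
  forall B, measurable B -> G ((fun w => X w + c * Y w) @^-1` B).
Proof.
move=> sG GX GY.
have mE (f : T -> R) : (forall B, measurable B -> G (f @^-1` B)) <->
    measurable_fun setT (f : g_sigma_algebraType G -> R).
  split=> [Gf _ B mB|mf B mB].
    by rewrite setTI; apply: sub_sigma_algebra; exact: Gf.
  have := mf measurableT B mB; rewrite setTI /measurable/=.
  by rewrite (sigma_algebra_id sG).
apply/mE; apply: measurable_funD; first exact/mE.
by apply: measurable_funM => //; exact/mE.
Qed.

Section brownian_increments.
Context (R : realType) (d : measure_display) (T : measurableType d)
  (P : probability T R) (F : R -> set (set T)) (W : R -> T -> R) (h : R)
  (c : nat -> R).
Hypotheses (hF : complete_filtration P F) (hW : brownian_motion P F W)
  (h0 : 0 < h).

Let S j w := \sum_(k < j) c k * increments W h w k.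

Let time_ge0 (j : nat) : 0 <= j%:R * h.
Proof. by rewrite mulr_ge0// ltW. Qed.

Let time_lt (j : nat) : j%:R * h < j.+1%:R * h.
Proof. by rewrite ltr_pM2r// ltr_nat. Qed.

Let timeB (j : nat) : j.+1%:R * h - j%:R * h = h.
Proof. by rewrite -mulrBl -natrB// subSnn mul1r. Qed.

(** This makes the next increment, which is independent of [F (j%:R * h)], independent of [S j]. *)
Lemma adapted_increments_sum j B : measurable B -> F (j%:R * h) (S j @^-1` B).
Proof.
case: hF => _ sF _ Fmono _; case: hW => adW _ _ _ _.
elim: j B => [|j IH] B mB.
  have [B0|nB0] := pselect (B 0).
    rewrite (_ : _ @^-1` _ = setT); last first.
      by apply/seteqP; split => // w _; rewrite /S/= big_ord0.
    by have [F0 FC _] := sF _ (time_ge0 0); rewrite -(setD0 setT); exact: FC.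
  rewrite (_ : _ @^-1` _ = set0); last first.
    by apply/seteqP; split => // w; rewrite /S/= big_ord0.
  by have [] := sF _ (time_ge0 0).
have FS := sF _ (time_ge0 j.+1).
have sub := Fmono _ _ (time_ge0 j) (ltW (time_lt j)).
(* The new end point of the increment is added first and the old one subtracted afterwards, each by
   one use of [sigma_algebra_preimageDM]. *)
pose V w := S j w + c j * W (j.+1%:R * h) w.
have FV A : measurable A -> F (j.+1%:R * h) (V @^-1` A).
  apply: sigma_algebra_preimageDM => // C mC; last exact: adW.
  by apply: sub; exact: IH.
rewrite (_ : S j.+1 = fun w => V w + - c j * W (j%:R * h) w); last first.
  by apply/funext => w; rewrite /S big_ord_recr/= /V /S /increments; ring.
apply: sigma_algebra_preimageDM mB => // C mC.
by apply: sub; exact: adW.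
Qed.

Lemma measurable_increments_sum j : measurable_fun setT (S j).
Proof.
case: hF => _ _ Fm _ _ _ B mB; rewrite setTI.
by apply: (Fm _ (time_ge0 j)); exact: adapted_increments_sum.
Qed.

Lemma measurable_increment j :
  measurable_fun setT (fun w => increments W h w j).
Proof.
case: hF => _ _ Fm _ _; case: hW => adW _ _ _ _.
have mW t : 0 <= t -> measurable_fun setT (W t).
  by move=> t0 _ B mB; rewrite setTI; apply: (Fm _ t0); exact: adW.
by apply: measurable_funB; exact: mW.
Qed.

Lemma scaled_increment_law j B : c j != 0 -> measurable B ->
  P ((fun w => c j * increments W h w j) @^-1` B) =
  normal_prob 0 (c j * Num.sqrt h) B.
Proof.
move=> cj0 mB; case: hW => _ _ _ lawW _.
have := lawW _ _ (time_ge0 j) (time_lt j) _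
  (measurable_preimage_affine _ (c j) 0 _ mB).
rewrite timeB normal_prob_affine//; last by rewrite sqrtr_eq0 -ltNge.
rewrite mulr0 addr0 => <-; congr (P _).
by apply/seteqP; split => w; rewrite /= addr0.
Qed.

(** Induction on [j] by independence of the last summand. Since [normal_prob] has a density even at
    standard deviation 0, it is no point mass there; hence the cases of a vanishing last weight and
    of vanishing earlier weights are treated apart. *)
Lemma increments_sum_law j B : \sum_(k < j) c k ^+ 2 != 0 -> measurable B ->
  P (S j @^-1` B) = normal_prob 0 (Num.sqrt (h * \sum_(k < j) c k ^+ 2)) B.
Proof.
elim: j B => [|j IH] B; first by rewrite big_ord0 eqxx.
have -> : S j.+1 = fun w => S j w + c j * increments W h w j.
  by apply/funext => w; rewrite /S big_ord_recr.
rewrite !big_ord_recr/=.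
have [cj0|cj0] := eqVneq (c j) 0.
  rewrite cj0 expr0n/= addr0 => s0 mB; rewrite -IH//; congr (P _).
  by apply/seteqP; split => w /=; rewrite mul0r addr0.
have sh0 : Num.sqrt h != 0 by rewrite sqrtr_eq0 -ltNge.
have csh2 : (c j * Num.sqrt h) ^+ 2 = h * c j ^+ 2.
  by rewrite exprMn sqr_sqrtr ?(ltW h0)// mulrC.
have [s0 _ mB|s0 _ mB] := eqVneq (\sum_(k < j) c k ^+ 2) 0.
  have c0 (k : 'I_j) : c k = 0.
    move/eqP: s0; rewrite psumr_eq0 => [/allP/(_ k)|i _]; last exact: sqr_ge0.
    by rewrite mem_index_enum => /(_ isT)/=; rewrite sqrf_eq0 => /eqP.
  rewrite s0 add0r -csh2 sqrtr_sqr normal_prob_norm -scaled_increment_law//.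
  congr (P _); apply/seteqP; split => w /=; rewrite /S big1 ?add0r// => k _;
    by rewrite c0 mul0r.
have sj0 : 0 < h * \sum_(k < j) c k ^+ 2.
  by rewrite mulr_gt0// lt0r s0 sumr_ge0// => k _; exact: sqr_ge0.
rewrite mulrDr -csh2 -[X in X + _](sqr_sqrtr (ltW sj0)).
rewrite (_ : normal_prob 0 = normal_prob (0 + 0)); last by rewrite addr0.
apply: probability_normalD mB.
- exact: measurable_increments_sum.
- by apply: measurable_funM => //; exact: measurable_increment.
- by rewrite sqrtr_eq0 -ltNge.
- by rewrite mulf_neq0.
- by move=> A mA; exact: IH.
- by move=> A mA; exact: scaled_increment_law.
- move=> A C mA mC; case: hW => _ _ _ _ indep.
  have := indep _ _ (time_ge0 j) (time_lt j) _ (adapted_increments_sum j _ mA)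
    _ (measurable_preimage_affine _ (c j) 0 _ mC).
  have -> : (W (j.+1%:R * h) \- W (j%:R * h)) @^-1`
      ((fun x => c j * x + 0) @^-1` C) =
      (fun w => c j * increments W h w j) @^-1` C.
    by apply/seteqP; split => w; rewrite /= addr0.
  by [].
Qed.

End brownian_increments.

(** Discrete variation of constants: the noise of step [k] enters along [b] and is carried on by the
    remaining [N.-1 - k] steps. *)
Lemma method_iterE (R : realType) (A : 'M[R]_2) (b : 'cV[R]_2) (alpha : R)
    (dW : nat -> R) (z : 'cV[R]_2) (N : nat) :
  method_iter A b alpha dW z N = iter N (mulmx A) z +
  \sum_(k < N) (alpha * dW k) *: iter (N.-1 - k) (mulmx A) b.
Proof.
elim: N => [|N IH] /=; first by rewrite big_ord0 addr0.
rewrite IH big_ord_recr /= subnn /= mulmxDr addrA; congr (_ + _ + _).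
rewrite mulmx_sumr; apply: eq_bigr => k _.
rewrite -scalemxAr -iterS; suff -> : ((N.-1 - k).+1 = N - k)%N by [].
by case: N k {IH} => [[]//|n] k /=; rewrite subSn// -ltnS ltn_ord.
Qed.

(** * The numerical method *)

Section mean_velocity.
Context (R : realType) (d : measure_display) (T : measurableType d)
  (P : probability T R) (F : R -> set (set T)) (W : R -> T -> R)
  (alpha x0 y0 h : R) (A : 'M[R]_2) (b : 'cV[R]_2).
Hypotheses (hF : complete_filtration P F) (hW : brownian_motion P F W)
  (alpha0 : 0 < alpha) (h0 : 0 < h)
  (b0 : b 0 0 ^+ 2 + b 1 0 ^+ 2 != 0) (A1 : condA1 A) (A2 : condA2 A).

Let p k := iter k (mulmx A) b 0 0.
Let q k := iter k (mulmx A) (vec2 x0 y0) 0 0.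
Let tau := \tr A.
Let Q := p 1 ^+ 2 - tau * p 0 * p 1 + p 0 ^+ 2.

Let tau4 : 0 < 4 - tau ^+ 2.
Proof. by move: A1; rewrite /condA1 A2 mulr1. Qed.

Let orbit_rec (z : 'cV[R]_2) k : iter k.+2 (mulmx A) z 0 0 =
  tau * iter k.+1 (mulmx A) z 0 0 - iter k (mulmx A) z 0 0.
Proof. by rewrite iter_mulmx2_rec A2 mul1r. Qed.

(** [4 * Q] is a sum of two nonnegative terms. If both vanish then [p 0 = p 1 = 0], so [b 0 0 = 0]
    and, as [b] is nonzero, [A 0 1 = 0]. Then [\det A = A 0 0 * A 1 1], and
    [4 * \det A - (\tr A) ^+ 2] is minus a square, against (A1). *)
Lemma mean_velocity_form_gt0 : 0 < Q.
Proof.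
have Q4 : 4 * Q = (2 * p 1 - tau * p 0) ^+ 2 + (4 - tau ^+ 2) * p 0 ^+ 2.
  by rewrite /Q; ring.
have sq1 := sqr_ge0 (2 * p 1 - tau * p 0).
have sq0 : 0 <= (4 - tau ^+ 2) * p 0 ^+ 2 by rewrite mulr_ge0 ?sqr_ge0// ltW.
rewrite ltNge; apply/negP => Qle0.
have p00 : p 0 = 0.
  have : (4 - tau ^+ 2) * p 0 ^+ 2 == 0 by rewrite eq_le sq0 andbT; lra.
  by rewrite mulf_eq0 (gt_eqF tau4)/= sqrf_eq0 => /eqP.
have p10 : p 1 = 0.
  have : (2 * p 1 - tau * p 0) ^+ 2 == 0 by rewrite eq_le sq1 andbT; lra.
  by rewrite p00 mulr0 subr0 sqrf_eq0 mulf_eq0 pnatr_eq0 => /eqP.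
have b10 : b 0 0 = 0 by exact: p00.
have b20 : b 1 0 != 0 by move: b0; rewrite b10 expr0n/= add0r sqrf_eq0.
move: p10; rewrite /p iterS mulmx2E/= b10 mulr0 add0r => /eqP.
rewrite mulf_eq0 (negPf b20) orbF => /eqP a12.
have := A2; rewrite /condA2 det2 a12 mul0r subr0 => A2'.
have := tau4; rewrite /tau mxtrace2 => A1'.
have := sqr_ge0 (A 0 0 - A 1 1); nra.
Qed.

(** The limit of [N] times the variance of the mean velocity: a factor [h] from the increments and
    [h ^ -2] from the division by [N h] leave [h ^ -1]. *)
Let v := alpha ^+ 2 / h * (2 / (4 - tau ^+ 2) * Q).

Lemma method_rateE y : method_rate alpha h A b y = (v *+ 2)^-1 * y ^+ 2.
Proof.
have Q0 := lt0r_neq0 mean_velocity_form_gt0.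
(* With [c] as in [method_rate], [p 1] equals [tau * b 0 0 + c], which turns the invariant form into
   the bracket of the rate function. *)
have QE : Q = (b 0 0 + (A 0 1 * b 1 0 - A 1 1 * b 0 0)) ^+ 2
    - b 0 0 * (A 0 1 * b 1 0 - A 1 1 * b 0 0) * (2 - \tr A).
  by rewrite /Q /p /tau iterS mulmx2E/= mxtrace2; ring.
rewrite /method_rate -QE /v -/tau; field.
by rewrite Q0 !lt0r_neq0.
Qed.

(** The weight of the increment [k] in the position after [N] steps. It depends on [N], but the sum
    of squares is that of the [p k] in reverse order. *)
Let c N k := alpha * p (N.-1 - k).
Let sigma N := Num.sqrt (h * \sum_(k < N) c N k ^+ 2).

Let sum_c N : \sum_(k < N) c N k ^+ 2 = alpha ^+ 2 * \sum_(k < N) p k ^+ 2.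
Proof.
rewrite mulr_sumr (reindex_inj rev_ord_inj)/=; apply: eq_bigr => k _.
rewrite /c exprMn; congr (_ * p _ ^+ 2).
by case: N k => [[]//|N] k /=; rewrite subSS subKn// -ltnS.
Qed.

Let cvg_variance : N%:R * ((N%:R * h)^-1 * sigma N) ^+ 2 @[N --> \oo] --> v.
Proof.
have : alpha ^+ 2 / h * (N%:R^-1 * (\sum_(k < N) p k ^+ 2)) @[N --> \oo] --> v.
  apply: cvgM; first exact: cvg_cst.
  by apply: elliptic_average_sqr => // k; exact: orbit_rec.
apply: cvg_trans; apply: near_eq_cvg; near=> N.
have N0 : (0 < N)%N by near: N; exact: nbhs_infty_gt.
rewrite exprMn sqr_sqrtr; last first.
  by rewrite mulr_ge0 ?(ltW h0)// sumr_ge0// => k _; exact: sqr_ge0.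
by rewrite sum_c; field; rewrite pnatr_eq0 -lt0n N0 lt0r_neq0.
Unshelve. all: by end_near. Qed.

Let v0 : 0 < v.
Proof.
by rewrite !mulr_gt0 ?invr_gt0 ?exprn_gt0// mean_velocity_form_gt0.
Qed.

Lemma mean_velocity_LDP :
  LDP_good P \oo (fun N : nat => N%:R)
    (discrete_mean_velocity A b alpha x0 y0 h W)
    (fun y => (method_rate alpha h A b y)%:E).
Proof.
rewrite (_ : (fun y => _) = fun y => ((v *+ 2)^-1 * y ^+ 2)%:E); last first.
  by apply/funext => y; rewrite method_rateE.
split.
  by apply: good_rate_function_quadratic; rewrite invr_gt0 mulrn_wgt0.
apply: (@gaussian_LDP _ _ _ _ _ (fun N => (N%:R * h)^-1 * q N)
  (fun N => (N%:R * h)^-1 * sigma N) v v0 _ cvg_variance).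
  (* The orbit of the initial value obeys the same recurrence as that of [b], so the means before
     division by [N h] are bounded. *)
  pose M := Num.sqrt
    (4 * (q 1 ^+ 2 - tau * q 0 * q 1 + q 0 ^+ 2) / (4 - tau ^+ 2)).
  under eq_fun do rewrite invfM -mulrA.
  apply: (@cvg_invn_bounded _ _ (h^-1 * M)) => N.
  rewrite normrM gtr0_norm ?invr_gt0// ler_wpM2l ?invr_ge0 ?(ltW h0)//.
  by apply: elliptic_bound => // k; exact: orbit_rec.
near=> N => B mB.
have N0 : (0 < N)%N by near: N; exact: nbhs_infty_gt.
have Nh0 : (N%:R * h)^-1 != 0.
  by rewrite invr_neq0// mulf_neq0 ?pnatr_eq0 -?lt0n// lt0r_neq0.
(* [sigma N] may vanish for small [N], for instance at [N = 1] when [b 0 0 = 0]; positivity of the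
   limit [v] excludes this for large [N]. *)
have var0 : N%:R * ((N%:R * h)^-1 * sigma N) ^+ 2 != 0.
  rewrite lt0r_neq0//; near: N; exact: (cvgr_gt v cvg_variance).
have sigma0 : sigma N != 0.
  by apply: contraNneq var0 => ->; rewrite mulr0 expr0n/= mulr0.
have sum0 : \sum_(k < N) c N k ^+ 2 != 0.
  by apply: contraNneq sigma0; rewrite /sigma => ->; rewrite mulr0 sqrtr0.
(* The mean is put in the form that exhibits the law as an affine image of the centred law of the
   noise sum. *)
rewrite -[X in normal_prob X](add0r) -(mulr0 (N%:R * h)^-1).
rewrite -normal_prob_affine//.
have mB' := measurable_preimage_affine
  _ (N%:R * h)^-1 ((N%:R * h)^-1 * q N) _ mB.
rewrite -(increments_sum_law _ _ _ _ _ _ _ _ hF hW h0 _ _ sum0 mB').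
congr (P _); apply/funext => w /=; congr B.
rewrite /discrete_mean_velocity method_iterE mxE summxE mulrC mulrDr addrC.
congr (_ * _ + _); apply: eq_bigr => k _.
by rewrite mxE /c /p; ring.
Unshelve. all: by end_near. Qed.

End mean_velocity.

(** * Symplecticity *)

Lemma diff_linear_combination (R : realType) (V : normedModType R)
    (f g : V -> R^o) (a c k : R) (p u : V) :
  differentiable f p -> differentiable g p ->
  'd (a *: f + c *: g + cst k) p u = a * 'd f p u + c * 'd g p u.
Proof.
move=> df dg.
have da : differentiable (a *: f) p := differentiableZ a df.
have dc : differentiable (c *: g) p := differentiableZ c dg.
have dac : differentiable (a *: f + c *: g) p := differentiableD da dc.
have dk : differentiable (cst (k : R^o)) p := differentiable_cst _ _.
have E1 := congr1 (fun F : V -> R^o => F u) (diffD dac dk).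
have E2 := congr1 (fun F : V -> R^o => F u) (diffD da dc).
have Ea := congr1 (fun F : V -> R^o => F u) (diffZ a df).
have Ec := congr1 (fun F : V -> R^o => F u) (diffZ c dg).
have Ek := congr1 (fun F : V -> R^o => F u) (diff_cst (k : R^o) p).
apply: (etrans E1); apply: (etrans (congr2 +%R E2 Ek)).
by apply: (etrans (addr0 _)); exact: (congr2 +%R Ea Ec).
Qed.

(** In one step of the method the noise only contributes the constants [k] and [l], which have zero
    differential. *)
Lemma wedge_diff_affine (R : realType) (A : 'M[R]_2) (f g : 'cV[R]_2 -> R^o)
    (k l : R) (p u v : 'cV[R]_2) : differentiable f p -> differentiable g p ->
  wedge_diff (A 0 0 *: f + A 0 1 *: g + cst k) (A 1 0 *: f + A 1 1 *: g + cst l)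
    p u v = \det A * wedge_diff f g p u v.
Proof.
move=> df dg; rewrite /wedge_diff det2.
(* Stated over variables because [ring] is very slow at comparing the atoms
   ['d f p u], ['d f p v], ['d g p u] and ['d g p v]. *)
have det2M (a00 a01 a10 a11 fu gu fv gv : R) :
  (a00 * fu + a01 * gu) * (a10 * fv + a11 * gv) -
  (a00 * fv + a01 * gv) * (a10 * fu + a11 * gu) =
  (a00 * a11 - a01 * a10) * (fu * gv - fv * gu) by ring.
have E a c m w := diff_linear_combination _ _ f g a c m p w df dg.
apply: (etrans (congr2 (fun s t => s - t)
  (congr2 *%R (E _ _ k u) (E _ _ l v)) (congr2 *%R (E _ _ k v) (E _ _ l u)))).
exact: det2M.
Qed.

Lemma method_symplectic (R : realType) (T : Type) (A : 'M[R]_2)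
    (b : 'cV[R]_2) (alpha h : R) (W : R -> T -> R) :
  condA2 A -> symplectic_method A b alpha h W.
Proof.
move=> A2 w; set dW := increments W h w.
pose x n i : 'cV[R]_2 -> R^o := fun z => method_iter A b alpha dW z n i 0.
have xS n i : x n.+1 i =
    A i 0 *: x n 0 + A i 1 *: x n 1 + cst ((alpha * dW n) * b i 0).
  by apply/funext => z; rewrite /x /= mxE mulmx2E mxE.
have dx n i p : differentiable (x n i) p.
  elim: n i => [|n IH] i; first exact: differentiable_coord.
  rewrite xS; apply: differentiableD; last exact: differentiable_cst.
  by apply: differentiableD; apply: differentiableZ; exact: IH.
split=> [n p|n p u v]; first by split; exact: dx.
apply: (etrans (congr2 (fun f g => wedge_diff f g p u v) (xS n 0) (xS n 1))).
apply: (etrans (wedge_diff_affine _ _ _ _ _ _ _ _ _ (dx n 0 p) (dx n 1 p))).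
by rewrite A2 mul1r.
Qed.

(** * The rate function for vanishing step-size *)

Lemma bigO_pow_cvg0 (R : realType) (f r : R -> R) (p : nat) :
  (forall h, `|f h| <= `|r h|) -> bigO_pow r p.+1 ->
  f h / h ^+ p @[h --> 0^'+] --> 0.
Proof.
move=> fr [C rC].
have lim0 : C * h @[h --> 0^'+] --> 0.
  rewrite -[X in _ --> X](mulr0 C); apply: cvg_at_right_filter.
  by apply: cvgM; [exact: cvg_cst|exact: cvg_id].
apply/norm_cvg0P; apply: (squeeze_cvgr _ (cvg_cst 0) lim0); near=> h.
have h0 : 0 < h by near: h; exact: nbhs_right_gt.
rewrite normr_ge0/= normrM normfV normrX (gtr0_norm h0).
rewrite ler_pdivrMr ?exprn_gt0//.
rewrite -mulrA -exprS; apply: (le_trans (fr h)).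
by near: h.
Unshelve. all: by end_near. Qed.

(** Numerator and denominator are written through the errors in (B), with those of [A] divided by
    [h], which all tend to 0; the remaining powers of [h] cancel exactly. *)
Lemma method_rate_cvg (R : realType) (alpha : R) (A : R -> 'M[R]_2)
    (b : R -> 'cV[R]_2) (y : R) : 0 < alpha ->
  (\forall h \near 0^'+, condA2 (A h)) -> condB A b ->
  method_rate alpha h (A h) (b h) y / h @[h --> 0^'+] -->
    oscillator_rate alpha y.
Proof.
move=> alpha0 A2 [BA Bb].
have id0 : h @[h --> 0^'+] --> (0 : R).
  by apply: cvg_at_right_filter; exact: cvg_id.
have id_neq0 : \forall h \near 0^'+, (h : R) != 0.
  by near=> h; rewrite gt_eqF//; near: h; exact: nbhs_right_gt.
have o1 (f : R -> R) : f h / h @[h --> 0^'+] --> 0 -> f h @[h --> 0^'+] --> 0.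
  move=> fh; have : f h / h * h @[h --> 0^'+] --> (0 * 0 : R) by exact: cvgM.
  rewrite mulr0; apply: cvg_trans; apply: near_eq_cvg.
  by apply: filterS id_neq0 => h h0; rewrite divfK.
have BAe (f : R -> R) : (forall h, `|f h| <= `|A h 0 0 - 1| + `|A h 1 1 - 1|
    + `|A h 0 1 - h| + `|A h 1 0 + h|) -> f h / h @[h --> 0^'+] --> 0.
  move=> fA; apply: (bigO_pow_cvg0 _ _ _ 1 _ BA) => h.
  by apply: (le_trans (fA h)); exact: ler_norm.
have Bbe (f : R -> R) : (forall h, `|f h| <= `|b h 0 0| + `|b h 1 0 - 1|) ->
    f h @[h --> 0^'+] --> 0.
  move=> fb; have := bigO_pow_cvg0 _ f _ 0 _ Bb.
  under eq_fun do rewrite expr0 divr1.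
  by apply=> h; apply: (le_trans (fb h)); exact: ler_norm.
have n0 (x : R) : 0 <= `|x| by [].
have e1 : (A h 0 0 - 1) / h @[h --> 0^'+] --> 0.
  by apply: BAe => h; rewrite -!addrA lerDl !addr_ge0.
have e2 : (A h 1 1 - 1) / h @[h --> 0^'+] --> 0.
  by apply: BAe => h; rewrite -!addrA addrCA lerDl !addr_ge0.
have e12 : (A h 0 1 - h) / h @[h --> 0^'+] --> 0.
  by apply: BAe => h; rewrite addrAC lerDr !addr_ge0.
have e21 : (A h 1 0 + h) / h @[h --> 0^'+] --> 0.
  by apply: BAe => h; rewrite lerDr !addr_ge0.
have b1 : b h 0 0 @[h --> 0^'+] --> 0 by apply: Bbe => h; rewrite lerDl.
have b2 : b h 1 0 - 1 @[h --> 0^'+] --> 0 by apply: Bbe => h; rewrite lerDr.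
(* For determinant 1, [2 - \tr (A h)] equals [(A h 0 0 - 1) * (A h 1 1 - 1) - A h 0 1 * A h 1 0],
   and [t h] is this divided by [h ^+ 2]. Condition (B) alone bounds the trace error by a multiple
   of [h ^+ 2] without giving its leading coefficient. *)
pose t h := (A h 0 0 - 1) / h * ((A h 1 1 - 1) / h) -
  ((A h 0 1 - h) / h + 1) * ((A h 1 0 + h) / h - 1).
have tl : t h @[h --> 0^'+] --> (0 * 0 - (0 + 1) * (0 - 1) : R).
  apply: cvgB; first exact: cvgM.
  by apply: cvgM; [apply: cvgD|apply: cvgB] => //; exact: cvg_cst.
(* This is [b h 0 0 + (A h 0 1 * b h 1 0 - A h 1 1 * b h 0 0)] divided by [h]; [b h 0 0] survives
   only with the small factor [A h 1 1 - 1]. *)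
pose s h := ((A h 0 1 - h) / h + 1) * (b h 1 0 - 1 + 1) -
  (A h 1 1 - 1) / h * b h 0 0.
have sl : s h @[h --> 0^'+] --> ((0 + 1) * (0 + 1) - 0 * 0 : R).
  apply: cvgB; last exact: cvgM.
  by apply: cvgM; apply: cvgD => //; exact: cvg_cst.
pose c h := s h * h - b h 0 0.
have cl : c h @[h --> 0^'+] --> (((0 + 1) * (0 + 1) - 0 * 0) * 0 - 0 : R).
  by apply: cvgB => //; apply: cvgM.
(* The bracket in the denominator of the rate, divided by [h ^+ 2]. *)
pose D h := s h ^+ 2 - b h 0 0 * c h * t h.
have Dl : D h @[h --> 0^'+] --> (1 : R).
  have : D h @[h --> 0^'+] -->
      (((0 + 1) * (0 + 1) - 0 * 0) * ((0 + 1) * (0 + 1) - 0 * 0) -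
      0 * (((0 + 1) * (0 + 1) - 0 * 0) * 0 - 0) *
      (0 * 0 - (0 + 1) * (0 - 1)) : R).
    apply: cvgB; first by apply: cvgM.
    by apply: cvgM => //; apply: cvgM.
  by rewrite (_ : _ - _ = 1 :> R) //; ring.
(* This is [2 + \tr (A h)], the other factor of [4 - \tr (A h) ^+ 2]. *)
have trl : (A h 0 0 - 1) + (A h 1 1 - 1) + 4 @[h --> 0^'+] --> (0 + 0 + 4 : R).
  by apply: cvgD; [apply: cvgD; exact: o1|exact: cvg_cst].
have : t h * (A h 0 0 - 1 + (A h 1 1 - 1) + 4) * y ^+ 2 / (4 * alpha ^+ 2 * D h)
    @[h --> 0^'+] --> oscillator_rate alpha y.
  rewrite (_ : oscillator_rate _ _ = (0 * 0 - (0 + 1) * (0 - 1)) * (0 + 0 + 4) *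
    y ^+ 2 / (4 * alpha ^+ 2 * 1)); last first.
    by rewrite /oscillator_rate; field; rewrite lt0r_neq0.
  apply: cvgM; first by apply: cvgM; [exact: cvgM|exact: cvg_cst].
  apply: cvgV.
    by rewrite mulr1 mulf_neq0 ?pnatr_eq0// lt0r_neq0 ?exprn_gt0.
  by apply: cvgM => //; exact: cvg_cst.
apply: cvg_trans; apply: near_eq_cvg; near=> h.
have h0 : h != 0 by near: h.
have Dh0 : 0 < D h by near: h; exact: (cvgr_gt _ Dl).
have detA : condA2 (A h) by near: h.
move: detA; rewrite /condA2 det2 => detA.
have trE : 2 - \tr (A h) = t h * h ^+ 2.
  rewrite mxtrace2 (_ : t h * h ^+ 2 = (A h 0 0 - 1) * (A h 1 1 - 1) -
    A h 0 1 * A h 1 0); last by rewrite /t; field.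
  have -> : A h 0 1 * A h 1 0 = A h 0 0 * A h 1 1 - 1 by rewrite -detA; ring.
  by ring.
have sE : b h 0 0 + (A h 0 1 * b h 1 0 - A h 1 1 * b h 0 0) = s h * h.
  by rewrite /s; field.
have cE : A h 0 1 * b h 1 0 - A h 1 1 * b h 0 0 = c h.
  by rewrite /c -sE; ring.
rewrite /method_rate sE cE trE.
have -> : 4 - \tr (A h) ^+ 2 = t h * h ^+ 2 * (A h 0 0 - 1 + (A h 1 1 - 1) + 4).
  by rewrite -trE mxtrace2; ring.
have -> : (s h * h) ^+ 2 - b h 0 0 * c h * (t h * h ^+ 2) = D h * h ^+ 2.
  by rewrite /D; ring.
by field; rewrite h0 !lt0r_neq0.
Unshelve. all: by end_near. Qed.

Theorem theorem5p2 (R : realType) (d : measure_display) (T : measurableType d)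
    (P : probability T R) (F : R -> set (set T)) (W : R -> T -> R)
    (alpha x0 y0 : R) (A : R -> 'M[R]_2) (b : R -> 'cV[R]_2)
    (hF : complete_filtration P F) (hW : brownian_motion P F W)
    (halpha : 0 < alpha)
    (hb : forall h, 0 < h -> (b h 0 0) ^+ 2 + (b h 1 0) ^+ 2 != 0) :
  [/\
      forall h, 0 < h -> condA1 (A h) -> condA2 (A h) ->
        symplectic_method (A h) (b h) alpha h W,
      forall h, 0 < h -> condA1 (A h) -> condA2 (A h) ->
        LDP_good P \oo (fun N : nat => N%:R)
          (discrete_mean_velocity (A h) (b h) alpha x0 y0 h W)
          (fun y => (method_rate alpha h (A h) (b h) y)%:E)
    &
      (\forall h \near 0^'+, condA1 (A h) /\ condA2 (A h)) -> condB A b ->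
        (forall y : R, method_rate alpha h (A h) (b h) y / h @[h --> 0^'+]
                       --> oscillator_rate alpha y) /\
        (* hypothesis: the large deviations principle of the exact solution *)
        (forall X Y : R -> T -> R,
           oscillator_solution P F W alpha x0 y0 X Y ->
           LDP_good P (pinfty_nbhs R) id (fun t w => X t w / t)
             (fun y => (oscillator_rate alpha y)%:E) ->
           asymptotically_preserves_LDP P (fun t w => X t w / t)
             (oscillator_rate alpha)
             (fun h => method_rate alpha h (A h) (b h)))].
Proof.
split.
- by move=> h _ _ A2; exact: method_symplectic.
- move=> h h0 A1 A2.
  exact: (mean_velocity_LDP _ _ _ _ _ _ _ _ _ _ _ _ hF hW halpha h0 (hb h h0)).
- move=> A12 BAb.
  have rate_cvg y : method_rate alpha h (A h) (b h) y / h @[h --> 0^'+] -->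
      oscillator_rate alpha y.
    by apply: method_rate_cvg => //; apply: filterS A12 => h [].
  by split.
Qed.
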